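(* The complexity of the String Algorithm (described in the context), run on $n+1$ points $t_0,t_1,\dots,t_n$, is $\mathcal{O}(n)$.
   Context: Points $t_i=(D_i,E_i)$, $i=0,1,\dots,n$, in the plane are given, with increasing (or nondecreasing) abscissas $D_0,D_1,\dots,D_n$. The algorithm maintains arrays of pointers $LN$ and $RN$. The concavity condition at $t_i$ is: slope of the segment from $t_{LN(i)}$ to $t_i$ is strictly greater than the slope of the segment from $t_i$ to $t_{RN(i)}$. Complexity is the number of elementary operations, where evaluating the concavity condition at a point, comparing or incrementing indices, and reading or modifying a pointer each count as a constant number of operations. **String Algorithm.** 1. Input: $t_0,\dots,t_n$. 2. Initialize: $j=0$; $LN(i)=i-1$ for $i=1,\dots,n$; $RN(i)=i+1$ for $i=0,\dots,n-1$. 3. Forward Step: $j\leftarrow j+1$. If $j\ne n$, set $i=j$ and go to Backward Step; else return $RN$ (and stop). 4. Backward Step: If the concavity condition is satisfied at $t_i$, go to Forward Step. Else (the point $t_i$ is dropped) set $LN(RN(i))=LN(i)$, $RN(LN(i))=RN(i)$, $RN(i)=\mathbf{null}$; then if $LN(i)\ne 0$, set $i\leftarrow LN(i)$ and go to Backward Step; else go to Forward Step. *)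

(* Defs.v *)
From mathcomp Require Import all_boot all_order all_algebra.
From mathcomp Require Import reals constructive_ereal.

Set Implicit Arguments.
Unset Strict Implicit.
Unset Printing Implicit Defensive.

Import Order.TTheory GRing.Theory Num.Theory.

Local Open Scope ring_scope.

(* The quotient of increments is undefined when the two abscissas coincide.
   The value of the slope is then given by [vert], an arbitrary convention. *)
Definition slope (R : realType) (vert : R * R -> R * R -> \bar R)
    (p q : R * R) : \bar R :=
  if p.1 == q.1 then vert p q else ((q.2 - p.2) / (q.1 - p.1))%:E.

Local Close Scope ring_scope.

(* Number of operations charged for each elementary action. *)
Record cost_model := CostModel {
  cost_concavity : nat;  (* evaluating the concavity condition at a point *)
  cost_compare : nat;    (* comparing two indices *)
  cost_incr : nat;       (* incrementing or decrementing an index *)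
  cost_assign : nat;     (* assigning an index *)
  cost_read : nat;       (* reading a pointer *)
  cost_write : nat       (* modifying a pointer *)
}.

(* [None] is the null pointer. *)
Definition pointers (n : nat) := {ffun 'I_n.+1 -> option 'I_n.+1}.

Record store (n : nat) := Store {
  idx : nat;  (* the index j *)
  LN : pointers n;
  RN : pointers n
}.

(* A computation yields its value, the new store and the number of operations
   executed; the result [None] signals the dereferencing of a null pointer. *)
Definition comp (n : nat) (A : Type) := store n -> option (A * store n * nat).

Definition ret n A (a : A) : comp n A := fun s => Some (a, s, 0).

Definition bind n A B (m : comp n A) (k : A -> comp n B) : comp n B :=
  fun s =>
    if m s is Some (a, s1, c1) then
      if k a s1 is Some (b, s2, c2) then Some (b, s2, c1 + c2) else None
    else None.

Notation "'let*' x := m 'in' k" := (bind m (fun x => k))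
  (at level 200, x name, m at level 200, k at level 200).
Notation "'do*' m 'in' k" := (bind m (fun _ => k))
  (at level 200, m at level 200, k at level 200).

Definition upd n (a : pointers n) (i : 'I_n.+1) (v : option 'I_n.+1) :
    pointers n :=
  [ffun k => if k == i then v else a k].

Definition charge n (c : nat) : comp n unit := fun s => Some (tt, s, c).

Definition deref n (v : option 'I_n.+1) : comp n 'I_n.+1 :=
  fun s => if v is Some k then Some (k, s, 0) else None.

Definition get_j n : comp n nat := fun s => Some (idx s, s, 0).

Arguments get_j {n}.

Inductive label (n : nat) : Type :=
  | Forward
  | Backward of 'I_n.+1
  | Stop.

Arguments Forward {n}.
Arguments Stop {n}.

Section StringAlgorithm.
Variables (cm : cost_model) (R : realType).
Variable vert : R * R -> R * R -> \bar R.
Variables (n : nat) (t : 'I_n.+1 -> R * R).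

Definition set_j (k : nat) : comp n unit :=
  fun s => Some (tt, Store k (LN s) (RN s), cost_assign cm).

Definition incr_j : comp n unit :=
  fun s => Some (tt, Store (idx s).+1 (LN s) (RN s), cost_incr cm).

Definition read_LN (i : 'I_n.+1) : comp n (option 'I_n.+1) :=
  fun s => Some (LN s i, s, cost_read cm).

Definition read_RN (i : 'I_n.+1) : comp n (option 'I_n.+1) :=
  fun s => Some (RN s i, s, cost_read cm).

Definition write_LN (i : 'I_n.+1) (v : option 'I_n.+1) : comp n unit :=
  fun s => Some (tt, Store (idx s) (upd (LN s) i v) (RN s), cost_write cm).

Definition write_RN (i : 'I_n.+1) (v : option 'I_n.+1) : comp n unit :=
  fun s => Some (tt, Store (idx s) (LN s) (upd (RN s) i v), cost_write cm).

Definition eq_index (k l : nat) : comp n bool :=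
  fun s => Some (k == l, s, cost_compare cm).

(* The two pointers read here are part of the evaluation of the condition,
   which is charged as a whole. *)
Definition concavity (i : 'I_n.+1) : comp n bool :=
  fun s =>
    if (LN s i, RN s i) is (Some l, Some r) then
      Some ((slope vert (t i) (t r) < slope vert (t l) (t i))%E, s,
            cost_concavity cm)
    else None.

(* Every iteration also pays for the management
   of the loop index. *)
Fixpoint for_each (r : seq 'I_n.+1) (body : 'I_n.+1 -> comp n unit) :
    comp n unit :=
  if r is i :: r' then
    do* charge (cost_incr cm + cost_compare cm) in
    do* body i in
    for_each r' body
  else ret tt.

(* The additional [cost_incr] pays for the computation of i - 1 or i + 1. *)
Definition initialize : comp n unit :=
  do* set_j 0 in
  do* for_each [seq i : 'I_n.+1 <- enum 'I_n.+1 | 0 < i]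
    (fun i => do* charge (cost_incr cm) in write_LN i (Some (inord i.-1))) in
  for_each [seq i : 'I_n.+1 <- enum 'I_n.+1 | i < n]
    (fun i => do* charge (cost_incr cm) in write_RN i (Some (inord i.+1))).

Definition forward_step : comp n (label n) :=
  do* incr_j in
  let* j := get_j in
  let* stop := eq_index j n in
  if stop then ret Stop
  else do* charge (cost_assign cm) in ret (Backward (inord j)).

Definition backward_step (i : 'I_n.+1) : comp n (label n) :=
  let* ok := concavity i in
  if ok then ret Forward
  else
    let* r1 := read_RN i in
    let* r := deref r1 in
    let* l1 := read_LN i in
    do* write_LN r l1 in
    let* l2 := read_LN i in
    let* l := deref l2 in
    let* r2 := read_RN i in
    do* write_RN l r2 in
    do* write_RN i None in
    let* l3 := read_LN i in
    let* k := deref l3 in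
    let* at0 := eq_index k 0 in
    if at0 then ret Forward
    else
      let* l4 := read_LN i in
      let* i' := deref l4 in
      do* charge (cost_assign cm) in ret (Backward i').

(* [runs lb s a c]: started at step [lb] in the store [s], the algorithm stops
   after [c] operations and returns [a]. *)
Inductive runs : label n -> store n -> pointers n -> nat -> Prop :=
  | runs_stop s : runs Stop s (RN s) 0
  | runs_forward s lb s' c a c' :
      forward_step s = Some (lb, s', c) -> runs lb s' a c' ->
      runs Forward s a (c + c')
  | runs_backward i s lb s' c a c' :
      backward_step i s = Some (lb, s', c) -> runs lb s' a c' ->
      runs (Backward i) s a (c + c').

Definition blank_store : store n :=
  Store 0 [ffun _ => None] [ffun _ => None].

(* On the points [t], the algorithm terminates without dereferencing a null
   pointer, returns [a], and executes [c] operations in total. *)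
Definition string_algorithm (a : pointers n) (c : nat) : Prop :=
  exists (s : store n) (c0 c1 : nat),
    [/\ initialize blank_store = Some (tt, s, c0),
        runs Forward s a c1 & c = c0 + c1].

End StringAlgorithm.

(* Main.v *)
Require Import Defs.
From mathcomp Require Import all_boot all_order all_algebra.
From mathcomp Require Import reals constructive_ereal.
From mathcomp Require Import zify.

(* Amortized analysis.  At every moment the pointers [LN] lead from the
   candidate point down to [t_0] along the points of index at most j that have
   not been dropped.  Every drop shortens this chain by one point, while a
   Forward Step lengthens it by at most one point.  Hence there are at most
   n Forward Steps, fewer than n drops, and fewer than n evaluations of the
   concavity condition with a positive answer. *)

Set Implicit Arguments.
Unset Strict Implicit.
Unset Printing Implicit Defensive.

Definition forward_cost (cm : cost_model) : nat :=
  cost_incr cm + cost_compare cm + cost_assign cm.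

(** Worst case: the point is dropped and its left neighbour is tested next, which takes six reads
    and three writes. *)
Definition backward_cost (cm : cost_model) : nat :=
  cost_concavity cm + 6 * cost_read cm + 3 * cost_write cm
  + cost_compare cm + cost_assign cm.

Definition init_cost (cm : cost_model) : nat :=
  2 * cost_incr cm + cost_compare cm + cost_write cm.

(** The list [p] omits [i] itself and ends at 0; its length is the potential of the amortized
    analysis. *)
Fixpoint chain n (L : pointers n) (i : 'I_n.+1) (p : seq 'I_n.+1) : Prop :=
  if p is l :: p' then [/\ L i = Some l, l < i & chain L l p'] else i = 0 :> nat.

(** Indices decrease along a chain, so a write above [i] cannot affect it. *)
Lemma eq_chain n (L L' : pointers n) (i : 'I_n.+1) p :
  (forall k : 'I_n.+1, k <= i -> L' k = L k) -> chain L i p -> chain L' i p.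
Proof.
elim: p i => [|l p IHp] //= i eqL [Li lt_li ch]; split=> //; first by rewrite eqL.
by apply: IHp ch => k le_kl; apply: eqL; apply: leq_trans le_kl (ltnW lt_li).
Qed.

(* The pointer [LN (j+1)] is left out because drops at points up to j redirect
   it: it points to the current end of the chain. *)
Definition fresh n (s : store n) : Prop :=
  (forall k : 'I_n.+1, (idx s).+1 < k -> LN s k = Some (inord k.-1)) /\
  (forall k : 'I_n.+1, idx s < k < n -> RN s k = Some (inord k.+1)).

Section Run.
Variables (cm : cost_model) (R : realType).
Variable vert : R * R -> R * R -> \bar R.
Variables (n : nat) (t : 'I_n.+1 -> R * R).

Lemma backward_stepE (i l r : 'I_n.+1) (s : store n) :
    LN s i = Some l -> RN s i = Some r -> i != r ->
  exists2 c, c <= backward_cost cm &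
    backward_step cm vert t i s = Some (Forward, s, c) \/
    backward_step cm vert t i s =
      Some (if l == 0 :> nat then Forward else Backward l,
            Store (idx s) (upd (LN s) r (Some l))
                  (upd (upd (RN s) l (Some r)) i None), c).
Proof.
move=> Li Ri ne_ir; rewrite /backward_step /bind /concavity Li Ri /=.
case: (_ < _)%E => /=; first by eexists; [|by left]; rewrite /backward_cost; lia.
(* [LN i] is read again after the write at [r]; since [r] differs from [i], it still yields [l]. *)
have Li' : upd (LN s) r (Some l) i = Some l by rewrite ffunE (negPf ne_ir).
rewrite Ri /= Li /= !Li' /= Ri /= !Li' /=.
by case: (l == 0 :> nat) => /=; rewrite ?Li' /=;
  (eexists; [|by right]); rewrite /backward_cost; lia.
Qed.

(** Induction on the chain: a drop is paid for by the point that leaves it. Of the two extra units,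
    one pays for a positive evaluation and one for the point [i] that then joins the chain of
    [j.+1]. *)
Lemma runs_backward_bound (m j : nat) :
    j < n ->
    (forall (s : store n) p, idx s = j -> fresh s -> chain (LN s) (inord j.+1) p ->
      exists a c, runs cm vert t Forward s a c /\
                  c <= backward_cost cm * size p + m) ->
  forall p (i : 'I_n.+1) (s : store n),
    idx s = j -> fresh s -> 0 < i <= j -> chain (LN s) i p ->
    LN s (inord j.+1) = Some i -> RN s i = Some (inord j.+1) ->
  exists a c, runs cm vert t (Backward i) s a c /\
              c <= backward_cost cm * (size p).+2 + m.
Proof.
move=> lt_jn fwd; have Ej : (inord j.+1 : 'I_n.+1) = j.+1 :> nat by rewrite inordK.
elim=> [|l p IHp] i s js fr /andP[i_gt0 le_ij]; first by move=> /= i0; lia.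
move=> /= [Li lt_li chl] Lj Ri.
have ne_ij : i != inord j.+1 by apply/eqP => /(congr1 val) /=; rewrite Ej; lia.
have [c le_c [step|step]] := backward_stepE Li Ri ne_ij.
  have [|a [c' [run le_c']]] := fwd s (i :: l :: p) js fr.
    by split=> //; rewrite Ej; lia.
  by exists a, (c + c'); split; [apply: runs_backward step run | move: le_c' => /=; lia].
set s' := Store _ _ _ in step.
(* The drop changes [LN] only at [j.+1], which lies above [i]. *)
have Ls' (k : 'I_n.+1) : k <= i -> LN s' k = LN s k.
  move=> le_ki; rewrite /s' ffunE; case: eqP => // Ek.
  by move: le_ki; rewrite Ek Ej; lia.
have chl' : chain (LN s') l p.
  by apply: eq_chain chl => k le_kl; apply: Ls'; lia.
have Lj' : LN s' (inord j.+1) = Some l by rewrite ffunE eqxx.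
have Rl' : RN s' l = Some (inord j.+1).
  rewrite /s' !ffunE eqxx; case: eqP => // El.
  by move: lt_li; rewrite El ltnn.
(* The writes hit [LN] at [j.+1] and [RN] at [l] and [i], both at most [j], hence outside the range
   of [fresh]. *)
have fr' : fresh s'.
  case: fr => frL frR; rewrite /fresh /= js in frL frR *; split=> k Hk; rewrite !ffunE.
    by case: eqP => [Ek|_]; [move: Hk; rewrite Ek Ej ltnn | apply: frL].
  case: eqP => [Ek|_]; first by move: Hk; rewrite Ek; lia.
  by case: eqP => [Ek|_]; [move: Hk; rewrite Ek; lia | apply: frR].
case: eqP step => [l0|l_neq0] step.
  have [|a [c' [run le_c']]] := fwd s' (l :: p) js fr'.
    by split=> //; rewrite Ej; lia.
  by exists a, (c + c'); split; [apply: runs_backward step run | move: le_c' => /=; lia].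
have [|a [c' [run le_c']]] := IHp l s' js fr' _ chl' Lj' Rl'; first by lia.
by exists a, (c + c'); split; [apply: runs_backward step run | move: le_c' => /=; lia].
Qed.

(** Here [m] counts the Forward Steps still to come, the stopping one included. It is positive
    because the algorithm stops only when the incremented index equals [n]. *)
Lemma runs_forward_bound (m : nat) (s : store n) p :
    0 < m -> idx s + m = n -> fresh s -> chain (LN s) (inord (idx s).+1) p ->
  exists a c, runs cm vert t Forward s a c /\
    c <= backward_cost cm * size p
         + (forward_cost cm + 2 * backward_cost cm) * m.
Proof.
elim: m s p => // m IHm s p _ Ejm fr ch.
pose s1 := Store (idx s).+1 (LN s) (RN s).
case: m IHm Ejm => [|m] IHm Ejm.
  exists (RN s1), (cost_incr cm + cost_compare cm + 0); split.
    apply: runs_forward (runs_stop _ _ _ _); rewrite /forward_step /bind /=.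
    have -> : (idx s).+1 == n by lia.
    by congr (Some (_, _, _)); lia.
  by rewrite /forward_cost; lia.
have step : forward_step cm s
    = Some (Backward (inord (idx s).+1), s1, forward_cost cm).
  rewrite /forward_step /bind /=.
  have -> : ((idx s).+1 == n) = false by lia.
  by congr (Some (_, _, _)); rewrite /forward_cost; lia.
case: fr => frL frR.
have Ej : (inord (idx s).+1 : 'I_n.+1) = (idx s).+1 :> nat by rewrite inordK; lia.
have Ej1 : (inord (idx s).+2 : 'I_n.+1) = (idx s).+2 :> nat by rewrite inordK; lia.
have fr1 : fresh s1 by split=> k /= Hk; [apply: frL | apply: frR]; lia.
(* The chain [p] becomes that of the new candidate, whose [RN], like the [LN] of its successor,
   still has its initial value by [fresh]. *)
have [|||||a [c [run le_c]]] := @runs_backward_bound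
    ((forward_cost cm + 2 * backward_cost cm) * m.+1) (idx s).+1 _ _
    p (inord (idx s).+1) s1 erefl fr1 _ ch.
- by lia.
- by move=> s2 q js2 fr2 ch2; apply: IHm; rewrite ?js2 //; lia.
- by rewrite Ej; lia.
- by rewrite /= frL Ej1 //; lia.
- by rewrite /= frR Ej //; lia.
exists a, (forward_cost cm + c); split; first exact: runs_forward step run.
by move: le_c; lia.
Qed.

(** The value written at [k] is always [f k], so the final array depends only on membership in
    [r]. *)
Lemma for_each_write_LN (f : 'I_n.+1 -> option 'I_n.+1) d r (s : store n) :
  exists L : pointers n,
    for_each cm r (fun i => do* charge d in write_LN cm i (f i)) s
      = Some (tt, Store (idx s) L (RN s),
              size r * (cost_incr cm + cost_compare cm + d + cost_write cm)) /\
    forall k, L k = if k \in r then f k else LN s k.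
Proof.
elim: r s => [|i r IHr] s /=; first by case: s => j L0 R0; exists L0.
have [L [E EL]] := IHr (Store (idx s) (upd (LN s) i (f i)) (RN s)).
exists L; split; first by rewrite /bind /= E /=; congr (Some (_, _, _)); lia.
move=> k; rewrite EL in_cons /= ffunE orbC; case: (k \in r) => //=.
by case: eqP => // ->.
Qed.

Lemma for_each_write_RN (f : 'I_n.+1 -> option 'I_n.+1) d r (s : store n) :
  exists Q : pointers n,
    for_each cm r (fun i => do* charge d in write_RN cm i (f i)) s
      = Some (tt, Store (idx s) (LN s) Q,
              size r * (cost_incr cm + cost_compare cm + d + cost_write cm)) /\
    forall k, Q k = if k \in r then f k else RN s k.
Proof.
elim: r s => [|i r IHr] s /=; first by case: s => j L0 R0; exists R0.
have [Q [E EQ]] := IHr (Store (idx s) (LN s) (upd (RN s) i (f i))).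
exists Q; split; first by rewrite /bind /= E /=; congr (Some (_, _, _)); lia.
move=> k; rewrite EQ in_cons /= ffunE orbC; case: (k \in r) => //=.
by case: eqP => // ->.
Qed.

Lemma initialize_bound :
  exists s c, [/\ initialize cm (blank_store n) = Some (tt, s, c),
    idx s = 0,
    forall k : 'I_n.+1, 0 < k -> LN s k = Some (inord k.-1),
    forall k : 'I_n.+1, k < n -> RN s k = Some (inord k.+1)
  & c <= cost_assign cm + 2 * n.+1 * init_cost cm].
Proof.
set rL := [seq i : 'I_n.+1 <- enum 'I_n.+1 | 0 < i].
set rR := [seq i : 'I_n.+1 <- enum 'I_n.+1 | i < n].
have szL : size rL <= n.+1.
  by rewrite size_filter (leq_trans (count_size _ _)) ?size_enum_ord.
have szR : size rR <= n.+1.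
  by rewrite size_filter (leq_trans (count_size _ _)) ?size_enum_ord.
have [L [EL LE]] := for_each_write_LN (fun i => Some (inord i.-1)) (cost_incr cm)
  rL (Store 0 (LN (blank_store n)) (RN (blank_store n))).
have [Q [EQ QE]] := for_each_write_RN (fun i => Some (inord i.+1)) (cost_incr cm)
  rR (Store 0 L (RN (blank_store n))).
do 2!eexists; split; first by rewrite /initialize {1 2}/bind /set_j EL /= EQ.
- by [].
- by move=> k k_gt0; rewrite /= LE mem_filter k_gt0 mem_enum.
- by move=> k lt_kn; rewrite /= QE mem_filter lt_kn mem_enum.
- by rewrite /init_cost; nia.
Qed.

End Run.

Theorem proposition3 (cm : cost_model) :
  exists C : nat,
    forall (R : realType) (vert : R * R -> R * R -> \bar R)
           (n : nat) (t : 'I_n.+1 -> R * R),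
      (0 < n)%N ->
      (forall i k : 'I_n.+1, (i <= k)%N -> ((t i).1 <= (t k).1)%R) ->
      exists (a : pointers n) (c : nat),
        string_algorithm cm vert t a c /\ (c <= C * n)%N.
Proof.
(* For positive [n], 2(n+1) is at most 4n, which bounds the initialization; 2n+1 is at most 3n,
   where the 1 is the length of the initial chain. *)
exists (cost_assign cm + 4 * init_cost cm + forward_cost cm + 3 * backward_cost cm).
move=> R vert n t n_gt0 _.
have [s [c0 [init j0 L0 R0 le_c0]]] := initialize_bound cm n.
have E1 : (inord 1 : 'I_n.+1) = 1 :> nat by rewrite inordK.
have fr : fresh s.
  by split=> k; rewrite j0 => Hk; [apply: L0 | apply: R0]; lia.
(* At the start the chain below index 1 consists of 0 alone. *)
have ch : chain (LN s) (inord (idx s).+1) [:: inord 0].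
  by rewrite j0; split; rewrite ?L0 ?E1 //= inordK.
have [|a [c1 [run le_c1]]] := runs_forward_bound cm vert t n_gt0 _ fr ch.
  by rewrite j0.
exists a, (c0 + c1); split; first by exists s, c0, c1.
by move: le_c1 => /=; nia.
Qed.
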